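(* Let $\mathbb{F}\in\{\mathbb{R},\mathbb{C}\}$, $q\ge2$, and let $\mathscr{O}=\{O_i\}_{i=1}^n$ be an $\alpha$-unitary design of self-adjoint $q\times q$ matrices over $\mathbb{F}$ with $\alpha>0$. Let $\hat\rho^{\mathrm{LSE}}$ be the unique minimizer of $\mathrm{Loss}[S]=\|\mathfrak{D}[S]-P\|_2^2$ over unit-trace self-adjoint matrices $S$. Then the unique Frobenius projection of $\hat\rho^{\mathrm{LSE}}$ onto the set $\mathbb{S}$ of density matrices is exactly the solution of the constrained regression problem: $$\arg\min\{\|\rho-\hat\rho^{\mathrm{LSE}}\|_2:\rho\in\mathbb{S}\}=\arg\min\{\mathrm{Loss}[\rho]:\rho\in\mathbb{S}\}.$$
   Context: $\mathbb{F}^{q\times q}_{sa}$ is the real vector space of self-adjoint (symmetric/Hermitian) $q\times q$ matrices with Frobenius inner product; $\|\cdot\|_2$ is the Frobenius norm. $\mathbb{S}$ is the set of non-negative definite trace-one matrices in $\mathbb{F}^{q\times q}_{sa}$. Each $O_i=\sum_{k=1}^{q_i}\lambda_{ik}\Pi_{ik}$ (distinct eigenvalues, orthogonal eigenprojections, $m_{ik}=\mathrm{Tr}[\Pi_{ik}]$, $q_i\ge2$). The index map is $k_i(\ell)=k$ iff $\sum_{k'<k}m_{ik'}<\ell\le\sum_{k'\le k}m_{ik'}$, $1\le\ell\le q$. The design tensor $\mathfrak{D}:\mathbb{F}^{q\times q}_{sa}\to\mathbb{R}^{n\times q}$ is $(\mathfrak{D}[S])_{i\ell}=\mathrm{Tr}[S\Pi_{i\,k_i(\ell)}]/m_{i\,k_i(\ell)}$;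 then $\frac{\mathfrak{D}^*\mathfrak{D}}{n}S=\frac1n\sum_{i,k}\frac{\mathrm{Tr}[S\Pi_{ik}]}{m_{ik}}\Pi_{ik}$. $\mathscr{O}$ is an $\alpha$-unitary design if $\frac{\mathfrak{D}^*\mathfrak{D}}{n}\Delta=\alpha\Delta$ for every traceless $\Delta\in\mathbb{F}^{q\times q}_{sa}$. For $\alpha>0$ the minimizer $\hat\rho^{\mathrm{LSE}}$ is unique and equals $(\mathfrak{D}^*\mathfrak{D})^{-1}\mathfrak{D}^*P$. Data: for each $i$ there are $r\ge1$ outcomes $Y_{i1},\dots,Y_{ir}\in\{\lambda_{i1},\dots,\lambda_{iq_i}\}$; $p_{ik}=\#\{j:Y_{ij}=\lambda_{ik}\}/r$, so $p_{ik}\ge0$, $\sum_kp_{ik}=1$. The data matrix $P\in\mathbb{R}^{n\times q}$ has entries $P_{i\ell}=p_{i\,k_i(\ell)}/m_{i\,k_i(\ell)}$. *)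

(* Defs.v *)
From HB Require Import structures.
From mathcomp Require Import all_boot all_order all_algebra.
From mathcomp Require Import complex.
From mathcomp Require Import boolp classical_sets reals.

Set Implicit Arguments.
Unset Strict Implicit.
Unset Printing Implicit Defensive.

Import Order.TTheory GRing.Theory Num.Theory.
Local Open Scope classical_set_scope.
Local Open Scope ring_scope.

(* The field F of scalars is either R or C = R[i].  Both are treated uniformly
   by an index of type [scalar_kind]; conjugation is trivial in the real case. *)
Variant scalar_kind := RealScalars | ComplexScalars.

Section Scalars.
Variable R : realType.

Definition scalar_field (K : scalar_kind) : numFieldType :=
  match K with RealScalars => R | ComplexScalars => R[i] end.

Definition sconj (K : scalar_kind) : scalar_field K -> scalar_field K :=
  match K with RealScalars => fun x => x | ComplexScalars => @conjc R end.

Definition sre (K : scalar_kind) : scalar_field K -> R :=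
  match K with RealScalars => fun x => x | ComplexScalars => @complex.Re R end.

Definition sreal (K : scalar_kind) : R -> scalar_field K :=
  match K with RealScalars => fun x => x | ComplexScalars => real_complex R end.

Lemma sreD (K : scalar_kind) : {morph @sre K : x y / x + y}.
Proof. by case: K => //= -[? ?] [? ?]. Qed.

Lemma sre0 (K : scalar_kind) : @sre K 0 = 0.
Proof. by case: K. Qed.

Lemma sre_sum (K : scalar_kind) (I : Type) (r : seq I) (F : I -> scalar_field K) :
  sre (\sum_(i <- r) F i) = \sum_(i <- r) sre (F i).
Proof. exact: (big_morph _ (@sreD K) (@sre0 K)). Qed.

Lemma sreM (K : scalar_kind) (a : R) (x : scalar_field K) :
  sre (sreal K a * x) = a * sre x.
Proof. by case: K x => //= -[x y] /=; rewrite mul0r subr0. Qed.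

Lemma sre_nat (K : scalar_kind) (n : nat) : @sre K n%:R = n%:R.
Proof.
by elim: n => [|n IH]; rewrite ?sre0 // -!natr1 sreD IH; case: K {IH}.
Qed.

Lemma sconjD (K : scalar_kind) : {morph @sconj K : x y / x + y}.
Proof. by case: K => //= x y; rewrite rmorphD. Qed.

Lemma sconj0 (K : scalar_kind) : @sconj K 0 = 0.
Proof. by case: K => //=; rewrite oppr0. Qed.

Lemma sconjM (K : scalar_kind) (a : R) (x : scalar_field K) :
  sconj (sreal K a * x) = sreal K a * sconj x.
Proof. by case: K x => //= x; rewrite rmorphM /= oppr0. Qed.

(* re (x x^* ) = |x|^2 *)
Lemma sre_mulconj_ge0 (K : scalar_kind) (x : scalar_field K) : 0 <= sre (x * sconj x).
Proof.
case: K x => [x|[x y]] /=; first by rewrite -expr2 sqr_ge0.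
by rewrite mulrN opprK -!expr2 addr_ge0 ?sqr_ge0.
Qed.

Lemma sre_mulconj_eq0 (K : scalar_kind) (x : scalar_field K) :
  sre (x * sconj x) = 0 -> x = 0.
Proof.
case: K x => [x|[x y]] /=; first by move/eqP; rewrite mulf_eq0 orbb => /eqP.
move/eqP; rewrite mulrN opprK -!expr2 paddr_eq0 ?sqr_ge0 // !sqrf_eq0.
by case/andP => /eqP-> /eqP->.
Qed.

End Scalars.

Section Matrices.
Variables (R : realType) (K : scalar_kind).
Local Notation F := (scalar_field R K).

Definition adj m n (A : 'M[F]_(m, n)) : 'M[F]_(n, m) :=
  map_mx (@sconj R K) A^T.

Definition self_adjoint q (A : 'M[F]_q) : Prop := adj A = A.

Definition frob_dot m n (A B : 'M[F]_(m, n)) : R := sre (\tr (A *m adj B)).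

Definition frob_norm m n (A : 'M[F]_(m, n)) : R := Num.sqrt (frob_dot A A).

(* In [F], [0 <= z] means that [z] is real and non-negative, also for F = C. *)
Definition nonneg_definite q (A : 'M[F]_q) : Prop :=
  self_adjoint A /\ forall x : 'cV[F]_q, 0 <= (adj x *m A *m x) 0 0.

Definition unit_trace_sa q : set 'M[F]_q :=
  [set A | self_adjoint A /\ \tr A = 1].

Definition density_matrices q : set 'M[F]_q :=
  [set A | nonneg_definite A /\ \tr A = 1].

(* A = \sum_k lambda_k Pi_k with at least two distinct eigenvalues, and Pi_k the
   orthogonal projection on the eigenspace of lambda_k. The order in which the
   eigenvalues are listed is arbitrary. *)
Record spectral_resolution q (A : 'M[F]_q) := SpectralResolution {
  nev : nat;
  eigval : 'I_nev -> R;
  eigproj : 'I_nev -> 'M[F]_q;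
  nev_ge2 : (2 <= nev)%N;
  eigval_inj : injective eigval;
  eigproj_neq0 : forall k, eigproj k != 0;
  eigproj_sa : forall k, self_adjoint (eigproj k);
  eigproj_idem : forall k, eigproj k *m eigproj k = eigproj k;
  eigproj_orth : forall k k', k != k' -> eigproj k *m eigproj k' = 0;
  eigproj_sum : \sum_k eigproj k = 1%:M;
  spectral_sum : A = \sum_k sreal K (eigval k) *: eigproj k }.

Section IndexMap.
Variables (q : nat) (A : 'M[F]_q) (s : spectral_resolution A).

Definition eigmult (k : 'I_(nev s)) : R := sre (\tr (eigproj k)).

(* The ordinal [l : 'I_q] stands for the 1-based index [l.+1]. *)
Definition in_block (k : 'I_(nev s)) (l : 'I_q) : bool :=
  \sum_(k' < nev s | (k' < k)%N) eigmult k' < l.+1%:R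
    <= \sum_(k' < nev s | (k' <= k)%N) eigmult k'.

(* The default value is never used: see [index_mapP]. *)
Definition index_map (l : 'I_q) : 'I_(nev s) :=
  odflt (Ordinal (ltnW (nev_ge2 s))) [pick k | in_block k l].

Lemma frob_dotE m n (B C : 'M[F]_(m, n)) :
  frob_dot B C = \sum_i \sum_j sre (B i j * sconj (C i j)).
Proof.
rewrite /frob_dot /mxtrace sre_sum; apply: eq_bigr => i _.
by rewrite mxE sre_sum; apply: eq_bigr => j _; rewrite !mxE.
Qed.

Lemma eigmult_gt0 k : 0 < eigmult k.
Proof.
have E : eigmult k = frob_dot (eigproj k) (eigproj k).
  by rewrite /frob_dot (eigproj_sa k) eigproj_idem.
have ge0 i j : 0 <= sre (eigproj k i j * sconj (eigproj k i j)).
  exact: sre_mulconj_ge0.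
rewrite E frob_dotE lt0r sumr_ge0 ?andbT => [|i _]; last exact: sumr_ge0.
apply: contra (eigproj_neq0 k) => /eqP Z.
apply/eqP/matrixP => i j; rewrite [RHS]mxE; apply: sre_mulconj_eq0.
have Zi := psumr_eq0P (fun i _ => sumr_ge0 _ (fun j _ => ge0 i j)) Z (i:=i) isT.
exact: (psumr_eq0P (fun j _ => ge0 i j) Zi (i:=j) isT).
Qed.

Lemma sum_eigmult : \sum_k eigmult k = q%:R.
Proof.
by rewrite -sre_sum -raddf_sum eigproj_sum /= mxtrace1 sre_nat.
Qed.

Lemma in_block_uniq k k' l : in_block k l -> in_block k' l -> k = k'.
Proof.
wlog lt : k k' / (k < k')%N => [H hk hk'|].
  case: (ltngtP k k') => [lt|lt|/val_inj //]; first exact: H.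
  by apply/esym; apply: H.
move=> /andP[_ h1] /andP[h2 _]; have := lt_le_trans h2 h1.
have S (j : 'I_(nev s)) : (j <= k)%N -> (j < k')%N.
  by move=> h; apply: leq_ltn_trans lt.
rewrite ltNge => /negP[]; rewrite [leLHS]big_mkcond [leRHS]big_mkcond.
apply: ler_sum => j _.
case: ifP => [/S -> //|_]; case: ifP => // _; exact/ltW/eigmult_gt0.
Qed.

Lemma in_block_exists l : exists k, in_block k l.
Proof.
pose P (j : nat) := l.+1%:R <= \sum_(k' < nev s | (k' <= j)%N) eigmult k'.
have n0 : (0 < nev s)%N := ltnW (nev_ge2 s).
have Pmax : P (nev s).-1.
  rewrite /P (eq_bigl predT) ?sum_eigmult ?ler_nat // => j.
  by rewrite -ltnS prednK // ltn_ord.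
have exP : exists j, P j by exists (nev s).-1.
case: (ex_minnP exP) => j Pj minj.
have jn : (j < nev s)%N.
  by apply: leq_ltn_trans (minj _ Pmax) _; rewrite prednK.
exists (Ordinal jn); rewrite /in_block /= [X in _ && X]Pj andbT ltNge.
apply/negP; case: j {jn} Pj minj => [|j] Pj minj.
  by rewrite big1 // lern0.
by move=> h; have := minj j h; rewrite ltnn.
Qed.

Lemma index_mapP k l : reflect (index_map l = k) (in_block k l).
Proof.
rewrite /index_map; case: pickP => [k1 /= b1|none].
  by apply: (iffP idP) => [/in_block_uniq/(_ b1)|<-].
by exfalso; case: (in_block_exists l) => k0; rewrite none.
Qed.

End IndexMap.

Section Design.
Variables (q n : nat) (O : 'I_n -> 'M[F]_q).
Variable s : forall i, spectral_resolution (O i).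

Definition design_tensor (S : 'M[F]_q) : 'M[R]_(n, q) :=
  \matrix_(i, l) (sre (\tr (S *m eigproj (index_map (s i) l)))
                  / eigmult (index_map (s i) l)).

(* Adjoint of [design_tensor]: see [design_tensor_adjointP]. *)
Definition design_tensor_adjoint (X : 'M[R]_(n, q)) : 'M[F]_q :=
  \sum_(i < n) \sum_(l < q)
    sreal K (X i l / eigmult (index_map (s i) l))
      *: eigproj (index_map (s i) l).

Definition unitary_design (alpha : R) : Prop :=
  forall D : 'M[F]_q, self_adjoint D -> \tr D = 0 ->
    sreal K n%:R^-1 *: design_tensor_adjoint (design_tensor D)
    = sreal K alpha *: D.

(* [Y i j] is the outcome of the j-th measurement of [O i]. *)
Definition frequency r (Y : 'I_n -> 'I_r -> R) i (k : 'I_(nev (s i))) : R :=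
  #|[pred j : 'I_r | Y i j == eigval k]|%:R / r%:R.

Definition data_matrix r (Y : 'I_n -> 'I_r -> R) : 'M[R]_(n, q) :=
  \matrix_(i, l) (frequency Y (index_map (s i) l)
                  / eigmult (index_map (s i) l)).

End Design.

End Matrices.

Arguments unit_trace_sa {R} K q.
Arguments density_matrices {R} K q.

Section Regression.
Variables (R : realType) (K : scalar_kind) (q n : nat).
Variables (O : 'I_n -> 'M[scalar_field R K]_q) (s : forall i, spectral_resolution (O i)).

Lemma design_tensor_adjointP (S : 'M[scalar_field R K]_q) (X : 'M[R]_(n, q)) :
  @frob_dot R RealScalars n q (design_tensor s S) X
  = frob_dot S (design_tensor_adjoint s X).
Proof.
have adj_sum I (r : seq I) (G : I -> 'M[scalar_field R K]_q) :
    adj (\sum_(i <- r) G i) = \sum_(i <- r) adj (G i).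
  apply: (big_morph (@adj R K q q)) => [A B|]; apply/matrixP => a b; rewrite !mxE.
    exact: sconjD.
  exact: sconj0.
have adjZ a (A : 'M[scalar_field R K]_q) : adj (sreal K a *: A) = sreal K a *: adj A.
  by apply/matrixP => x y; rewrite !mxE sconjM.
rewrite frob_dotE /frob_dot /design_tensor_adjoint adj_sum mulmx_sumr.
rewrite raddf_sum sre_sum; apply: eq_bigr => i _.
rewrite adj_sum mulmx_sumr raddf_sum sre_sum; apply: eq_bigr => l _ /=.
rewrite adjZ eigproj_sa -scalemxAr mxtraceZ sreM mxE.
by rewrite mulrAC -mulrA mulrC.
Qed.

Definition loss (P : 'M[R]_(n, q)) (S : 'M[scalar_field R K]_q) : R :=
  @frob_norm R RealScalars n q (design_tensor s S - P) ^+ 2.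

End Regression.

Definition argmin (R : realType) (T : Type) (f : T -> R) (A : set T) : set T :=
  [set x | A x /\ forall y, A y -> f x <= f y].

(* Main.v *)
(* The design hypothesis says that D^*D / n is alpha times the identity on
   traceless self-adjoint matrices.  Expanding the quadratic loss around its
   minimizer L over unit-trace self-adjoint matrices, where the gradient is a
   multiple of the identity matrix, therefore gives
     Loss S = Loss L + n alpha ||S - L||_2^2
   for every unit-trace self-adjoint S, so on density matrices the loss and the
   distance to L are minimized at the same points.  The projection on density
   matrices exists by compactness and is unique by the parallelogram identity. *)
Require Import Defs.
From mathcomp Require Import all_boot all_order all_algebra.
From mathcomp Require Import boolp classical_sets reals.
From mathcomp Require Import complex topology normedtype derive.
From mathcomp Require Import ring lra.

Set Implicit Arguments.
Unset Strict Implicit.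
Unset Printing Implicit Defensive.

Import Order.TTheory GRing.Theory Num.Theory.
Import numFieldNormedType.Exports.
Local Open Scope classical_set_scope.
Local Open Scope ring_scope.

(** * Real and imaginary parts of scalars, uniformly in the field *)

Section ScalarParts.
Variables (R : realType) (K : scalar_kind).
Local Notation F := (scalar_field R K).

(** Taking 0 for real scalars makes the complex formulas for products, conjugation and positivity
    valid over both fields, so few later proofs need a case analysis on [K]. *)
Definition sim : F -> R :=
  match K with RealScalars => fun=> 0 | ComplexScalars => @complex.Im R end.

Lemma simD : {morph sim : x y / x + y}.
Proof. by rewrite /sim; case: K => /= [x y|[? ?] [? ?]] //; rewrite addr0. Qed.

Lemma sreMM (x y : F) : sre (x * y) = sre x * sre y - sim x * sim y.
Proof.
by rewrite /sim; case: K x y => /= [x y|[? ?] [? ?]] //; rewrite mul0r subr0.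
Qed.

Lemma simM (x y : F) : sim (x * y) = sre x * sim y + sim x * sre y.
Proof.
by rewrite /sim; case: K x y => /= [x y|[? ?] [? ?]] //; rewrite mul0r mulr0 addr0.
Qed.

Lemma sre_conj (x : F) : sre (sconj x) = sre x.
Proof. by case: K x => //= -[]. Qed.

Lemma sim_conj (x : F) : sim (sconj x) = - sim x.
Proof. by rewrite /sim; case: K x => //= [_|[]//]; rewrite oppr0. Qed.

Lemma sre_real (a : R) : sre (sreal K a) = a.
Proof. by case: K. Qed.

Lemma sim_real (a : R) : sim (sreal K a) = 0.
Proof. by rewrite /sim; case: K. Qed.

Lemma scalar_eqP (x y : F) : x = y <-> sre x = sre y /\ sim x = sim y.
Proof.
split=> [-> //|]; rewrite /sim.
by case: K x y => /= [x y []|[? ?] [? ?] /= [-> ->]].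
Qed.

Lemma scalar_ge0P (x : F) : 0 <= x <-> 0 <= sre x /\ sim x = 0.
Proof.
rewrite /sim; case: K x => /= [x|[a b]] /=; first by split=> [|[]].
by rewrite lecE /= ; split=> [/andP[/eqP -> ->]|[-> ->]]; rewrite ?eqxx.
Qed.

Lemma srealD : {morph @sreal R K : x y / x + y}.
Proof. by case: K => //= x y; rewrite rmorphD. Qed.

Lemma sreal_mul : {morph @sreal R K : x y / x * y}.
Proof. by case: K => //= x y; rewrite rmorphM. Qed.

Lemma sreal1 : sreal K 1 = 1 :> F.
Proof. by case: K. Qed.

Lemma sreal0 : sreal K 0 = 0 :> F.
Proof. by case: K. Qed.

Lemma srealN (a : R) : sreal K (- a) = - sreal K a.
Proof. by case: K => //=; rewrite rmorphN. Qed.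

Lemma sreal_nat (m : nat) : sreal K m%:R = m%:R :> F.
Proof. by elim: m => [|m IH]; rewrite ?sreal0 // -!natr1 srealD IH sreal1. Qed.

Lemma sreal_ge0 (a : R) : 0 <= a -> 0 <= sreal K a.
Proof. by move=> a0; apply/scalar_ge0P; rewrite sre_real sim_real. Qed.

Lemma sconj_real (a : R) : sconj (sreal K a) = sreal K a.
Proof. by apply/scalar_eqP; rewrite sre_conj sim_conj sim_real oppr0. Qed.

Lemma sconj_fix (x : F) : sconj x = x -> x = sreal K (sre x).
Proof.
move=> /scalar_eqP[_]; rewrite sim_conj => ?.
by apply/scalar_eqP; rewrite sre_real sim_real; split=> //; lra.
Qed.

Lemma sconj_sum I (r : seq I) (G : I -> F) :
  sconj (\sum_(i <- r) G i) = \sum_(i <- r) sconj (G i).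
Proof. exact: (big_morph _ (@sconjD R K) (@sconj0 R K)). Qed.

Lemma sre_mulconj (x y : F) : sre (x * sconj y) = sre x * sre y + sim x * sim y.
Proof. by rewrite sreMM sre_conj sim_conj mulrN opprK. Qed.

End ScalarParts.

(** * The Frobenius inner product as a real Euclidean structure *)

Section Frobenius.
Variables (R : realType) (K : scalar_kind).
Local Notation F := (scalar_field R K).

Lemma frob_dotE_parts m n (A B : 'M[F]_(m, n)) :
  frob_dot A B = \sum_i \sum_j (sre (A i j) * sre (B i j) + sim (A i j) * sim (B i j)).
Proof.
by rewrite frob_dotE; do 2!apply: eq_bigr => ? _; rewrite sre_mulconj.
Qed.

Lemma frob_dotC m n (A B : 'M[F]_(m, n)) : frob_dot A B = frob_dot B A.
Proof.
rewrite !frob_dotE_parts; do 2!apply: eq_bigr => ? _.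
by rewrite mulrC [X in _ + X]mulrC.
Qed.

Lemma frob_dotDl m n (A B C : 'M[F]_(m, n)) :
  frob_dot (A + B) C = frob_dot A C + frob_dot B C.
Proof. by rewrite /frob_dot mulmxDl raddfD sreD. Qed.

Lemma frob_dotZl m n a (A B : 'M[F]_(m, n)) :
  frob_dot (sreal K a *: A) B = a * frob_dot A B.
Proof. by rewrite /frob_dot -scalemxAl mxtraceZ sreM. Qed.

Lemma frob_dotNl m n (A B : 'M[F]_(m, n)) : frob_dot (- A) B = - frob_dot A B.
Proof. by rewrite -scaleN1r -(sreal1 R K) -srealN frob_dotZl mulN1r. Qed.

Lemma frob_dotDr m n (A B C : 'M[F]_(m, n)) :
  frob_dot A (B + C) = frob_dot A B + frob_dot A C.
Proof. by rewrite !(frob_dotC A) frob_dotDl. Qed.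

Lemma frob_dotZr m n a (A B : 'M[F]_(m, n)) :
  frob_dot A (sreal K a *: B) = a * frob_dot A B.
Proof. by rewrite !(frob_dotC A) frob_dotZl. Qed.

Lemma frob_dotNr m n (A B : 'M[F]_(m, n)) : frob_dot A (- B) = - frob_dot A B.
Proof. by rewrite !(frob_dotC A) frob_dotNl. Qed.

Lemma frob_dot_ge0 m n (A : 'M[F]_(m, n)) : 0 <= frob_dot A A.
Proof. by rewrite frob_dotE; do 2!apply: sumr_ge0 => ? _; exact: sre_mulconj_ge0. Qed.

(** Serves twice: for definiteness of the inner product, and to bound matrix coordinates in the
    compactness argument. *)
Lemma frob_dot_entry m n (A : 'M[F]_(m, n)) i j :
  sre (A i j) ^+ 2 + sim (A i j) ^+ 2 <= frob_dot A A.
Proof.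
have ge0 k l : 0 <= sre (A k l) * sre (A k l) + sim (A k l) * sim (A k l).
  by rewrite -!expr2 addr_ge0 ?sqr_ge0.
rewrite frob_dotE_parts (bigD1 i) //= (bigD1 j) //= -!expr2 -addrA lerDl.
by rewrite addr_ge0 ?sumr_ge0 // => k _; rewrite sumr_ge0.
Qed.

Lemma frob_dot_eq0 m n (A : 'M[F]_(m, n)) : frob_dot A A = 0 -> A = 0.
Proof.
move=> A0; apply/matrixP => i j; rewrite mxE.
have := frob_dot_entry A i j; rewrite A0 => le0.
have := sqr_ge0 (sre (A i j)); have := sqr_ge0 (sim (A i j)) => s1 s2.
apply/scalar_eqP; rewrite -(sreal0 R K) sre_real sim_real.
by split; apply/eqP; rewrite -sqrf_eq0; apply/eqP; lra.
Qed.

Lemma sqr_frob_norm m n (A : 'M[F]_(m, n)) : frob_norm A ^+ 2 = frob_dot A A.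
Proof. by rewrite sqr_sqrtr // frob_dot_ge0. Qed.

Lemma ler_frob_norm m n p (A : 'M[F]_(m, n)) (B : 'M[F]_(m, p)) :
  (frob_norm A <= frob_norm B) = (frob_dot A A <= frob_dot B B).
Proof. by rewrite ler_sqrt // frob_dot_ge0. Qed.

End Frobenius.

(** * Self-adjoint matrices as a real vector space *)

Section SelfAdjoint.
Variables (R : realType) (K : scalar_kind).
Local Notation F := (scalar_field R K).

Lemma adjD m n (A B : 'M[F]_(m, n)) : adj (A + B) = adj A + adj B.
Proof. by apply/matrixP => i j; rewrite !mxE sconjD. Qed.

Lemma adjZ m n a (A : 'M[F]_(m, n)) : adj (sreal K a *: A) = sreal K a *: adj A.
Proof. by apply/matrixP => i j; rewrite !mxE sconjM. Qed.

Lemma self_adjointD q (A B : 'M[F]_q) :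
  self_adjoint A -> self_adjoint B -> self_adjoint (A + B).
Proof. by rewrite /self_adjoint adjD => -> ->. Qed.

Lemma self_adjointZ q a (A : 'M[F]_q) :
  self_adjoint A -> self_adjoint (sreal K a *: A).
Proof. by rewrite /self_adjoint adjZ => ->. Qed.

Lemma self_adjointB q (A B : 'M[F]_q) :
  self_adjoint A -> self_adjoint B -> self_adjoint (A - B).
Proof.
by move=> hA hB; apply: self_adjointD => //; rewrite -scaleN1r -(sreal1 R K) -srealN;
   apply: self_adjointZ.
Qed.

Lemma self_adjoint_sum q I (r : seq I) (G : I -> 'M[F]_q) :
  (forall i, self_adjoint (G i)) -> self_adjoint (\sum_(i <- r) G i).
Proof.
move=> hG; apply: (big_ind (@self_adjoint R K q)) => //; last exact: self_adjointD.
by apply/matrixP => i j; rewrite !mxE sconj0.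
Qed.

Lemma self_adjoint1 q : self_adjoint (1%:M : 'M[F]_q).
Proof.
by apply/matrixP => i j; rewrite !mxE eq_sym -(sreal_nat R K) sconj_real.
Qed.

(** Diagonal entries are fixed by conjugation. A real multiple of the identity can therefore cancel
    the trace of the gradient. *)
Lemma mxtrace_self_adjoint q (A : 'M[F]_q) :
  self_adjoint A -> \tr A = sreal K (sre (\tr A)).
Proof.
move=> hA; apply: sconj_fix; rewrite /mxtrace sconj_sum.
by apply: eq_bigr => i _; rewrite -{2}hA !mxE.
Qed.

Lemma frob_dot1r q (A : 'M[F]_q) : frob_dot A 1%:M = sre (\tr A).
Proof. by rewrite /frob_dot self_adjoint1 mulmx1. Qed.

End SelfAdjoint.

(** * The loss on unit-trace self-adjoint matrices *)

Section LeastSquares.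
Variables (R : realType) (K : scalar_kind) (q n : nat).
Local Notation F := (scalar_field R K).
Variables (O : 'I_n -> 'M[F]_q) (s : forall i, spectral_resolution (O i)).

Lemma design_tensorD (A B : 'M[F]_q) :
  design_tensor s (A + B) = design_tensor s A + design_tensor s B.
Proof. by apply/matrixP => i l; rewrite !mxE mulmxDl raddfD sreD mulrDl. Qed.

Lemma design_tensor_adjointD (X Z : 'M[R]_(n, q)) :
  design_tensor_adjoint s (X + Z)
  = design_tensor_adjoint s X + design_tensor_adjoint s Z.
Proof.
rewrite -big_split; apply: eq_bigr => i _; rewrite -big_split.
by apply: eq_bigr => l _; rewrite mxE mulrDl srealD scalerDl.
Qed.

Lemma design_tensor_adjoint_sa (X : 'M[R]_(n, q)) :
  self_adjoint (design_tensor_adjoint s X).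
Proof.
by do 2!apply: self_adjoint_sum => ?; apply: self_adjointZ; exact: eigproj_sa.
Qed.

Variable alpha : R.
Hypotheses (n_gt0 : (0 < n)%N) (design : unitary_design s alpha).

Lemma design_gram (D : 'M[F]_q) : self_adjoint D -> \tr D = 0 ->
  design_tensor_adjoint s (design_tensor s D) = sreal K (n%:R * alpha) *: D.
Proof.
move=> hD tD; rewrite sreal_mul -scalerA -design // scalerA -sreal_mul.
by rewrite divff ?pnatr_eq0 -?lt0n // sreal1 scale1r.
Qed.

(** The loss is quadratic, so its second-order expansion is exact. Passing to the adjoint turns the
    quadratic term into the inner product of [D] with its image under the Gram operator, which by
    the design property is [n alpha] times the squared norm of [D]. *)
Lemma loss_expand (P : 'M[R]_(n, q)) (S D : 'M[F]_q) :
  self_adjoint D -> \tr D = 0 ->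
  loss s P (S + D) = loss s P S
    + 2 * frob_dot D (design_tensor_adjoint s (design_tensor s S - P))
    + n%:R * alpha * frob_dot D D.
Proof.
move=> hD tD; rewrite -(frob_dotZr (n%:R * alpha)) -design_gram // -design_tensor_adjointP.
rewrite -design_tensor_adjointP /loss !sqr_frob_norm design_tensorD addrAC.
move: (design_tensor s S - P) (design_tensor s D) => X Z.
have -> : @frob_dot R RealScalars n q (X + Z) (X + Z)
   = @frob_dot R RealScalars n q X X + @frob_dot R RealScalars n q Z X
     + (@frob_dot R RealScalars n q Z X + @frob_dot R RealScalars n q Z Z).
  by rewrite (@frob_dotDl R RealScalars) !(@frob_dotDr R RealScalars)
             (@frob_dotC R RealScalars _ _ X Z).
by ring.
Qed.

(** On traceless directions the Hessian is a multiple of the identity, so a single Newton step from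
    any unit-trace self-adjoint matrix reaches the minimizer. *)
Lemma loss_unit_trace (P : 'M[R]_(n, q)) : (0 < q)%N -> 0 < alpha ->
  exists2 L, unit_trace_sa K q L & forall S, unit_trace_sa K q S ->
    loss s P S = loss s P L + n%:R * alpha * frob_dot (S - L) (S - L).
Proof.
move=> q_gt0 alpha_gt0.
have q0 : q%:R != 0 :> R by rewrite pnatr_eq0 -lt0n.
have na0 : n%:R * alpha != 0 by rewrite mulf_neq0 ?pnatr_eq0 -?lt0n // gt_eqF.
(* The maximally mixed state is the starting point. *)
pose I0 : 'M[F]_q := sreal K q%:R^-1 *: 1%:M.
have saI0 : self_adjoint I0 by apply/self_adjointZ/self_adjoint1.
have trI0 : \tr I0 = 1.
  by rewrite mxtraceZ mxtrace1 -(sreal_nat R K) -sreal_mul mulVf // sreal1.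
pose G0 := design_tensor_adjoint s (design_tensor s I0 - P).
have saG0 : self_adjoint G0 := design_tensor_adjoint_sa _.
(* [G0] is half the gradient at [I0], and [t] is chosen so that [G0 - t I] is traceless. [D] is the
   Newton step along this traceless part. *)
pose t := sre (\tr G0) / q%:R.
pose D := sreal K (- (n%:R * alpha)^-1) *: (G0 - sreal K t *: 1%:M).
have saD : self_adjoint D.
  by apply/self_adjointZ/self_adjointB => //; apply/self_adjointZ/self_adjoint1.
have trD : \tr D = 0.
  rewrite mxtraceZ raddfB /= mxtraceZ mxtrace1 (mxtrace_self_adjoint saG0).
  by rewrite -(sreal_nat R K q) -sreal_mul divfK // subrr mulr0.
exists (I0 + D); first by split; [exact: self_adjointD | rewrite raddfD /= trI0 trD addr0].
move=> S [saS trS]; have saSL : self_adjoint (S - (I0 + D)).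
  by apply: self_adjointB => //; exact: self_adjointD.
have trSL : \tr (S - (I0 + D)) = 0.
  by rewrite raddfB raddfD /= trS trI0 trD addr0 subrr.
(* The step changes the half-gradient by [n alpha D = -(G0 - t I)], which leaves only [t I]. *)
have gradE : design_tensor_adjoint s (design_tensor s (I0 + D) - P) = sreal K t *: 1%:M.
  rewrite design_tensorD addrAC design_tensor_adjointD -/G0 design_gram // scalerA.
  by rewrite -sreal_mul mulrN divff // srealN sreal1 scaleN1r opprB subrKC.
(* The linear term vanishes because [S - L] is traceless, hence orthogonal to the identity. *)
rewrite -{1}(subrKC (I0 + D) S) (loss_expand P _ saSL trSL) gradE.
by rewrite frob_dotZr frob_dot1r trSL sre0 !mulr0 addr0.
Qed.

End LeastSquares.

(** * Frobenius projection onto the density matrices *)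

Section Projection.
Variables (R : realType) (K : scalar_kind).
Local Notation F := (scalar_field R K).

(** * Closed sets cut out by continuous scalar functions *)

Section ContinuousScalars.
Variable T : topologicalType.

(** Stated through real and imaginary parts, so that only the topology of [R] is involved and both
    fields are treated alike. *)
Definition scalar_continuous (f : T -> F) :=
  continuous (fun t => sre (f t)) /\ continuous (fun t => sim (f t)).

Lemma scalar_continuous_cst c : scalar_continuous (fun=> c).
Proof. by split=> t; exact: cvg_cst. Qed.

Lemma scalar_continuous_real (f : T -> R) :
  continuous f -> scalar_continuous (fun t => sreal K (f t)).
Proof.
move=> cf; split=> t.
  by under eq_fun do rewrite sre_real; exact: cf.
by under eq_fun do rewrite sim_real; exact: cvg_cst.
Qed.

Lemma scalar_continuousD f g : scalar_continuous f -> scalar_continuous g ->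
  scalar_continuous (fun t => f t + g t).
Proof.
move=> [f1 f2] [g1 g2]; split=> t.
  by under eq_fun do rewrite sreD; exact: cvgD (f1 t) (g1 t).
by under eq_fun do rewrite simD; exact: cvgD (f2 t) (g2 t).
Qed.

Lemma scalar_continuousM f g : scalar_continuous f -> scalar_continuous g ->
  scalar_continuous (fun t => f t * g t).
Proof.
move=> [f1 f2] [g1 g2]; split=> t.
  under eq_fun do rewrite sreMM.
  exact: cvgB (cvgM (f1 t) (g1 t)) (cvgM (f2 t) (g2 t)).
under eq_fun do rewrite simM.
exact: cvgD (cvgM (f1 t) (g2 t)) (cvgM (f2 t) (g1 t)).
Qed.

Lemma scalar_continuous_conj f : scalar_continuous f ->
  scalar_continuous (fun t => sconj (f t)).
Proof.
move=> [f1 f2]; split=> t.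
  by under eq_fun do rewrite sre_conj; exact: f1.
by under eq_fun do rewrite sim_conj; exact: cvgN (f2 t).
Qed.

Lemma scalar_continuous_sum I (r : seq I) (f : I -> T -> F) :
  (forall i, scalar_continuous (f i)) ->
  scalar_continuous (fun t => \sum_(i <- r) f i t).
Proof.
move=> cf; elim: r => [|i r IH].
  by under eq_fun do rewrite big_nil; exact: scalar_continuous_cst.
by under eq_fun do rewrite big_cons; exact: scalar_continuousD.
Qed.

Lemma closed_real_eq (f g : T -> R) : continuous f -> continuous g ->
  closed [set t | f t = g t].
Proof.
move=> cf cg.
rewrite (_ : mkset _ = (fun t => f t - g t) @^-1` [set x | x = 0]).
  apply: preimage_closed => [t _|]; last exact: closed_eq.
  exact: cvgB (cf t) (cg t).
by apply/seteqP; split=> t /=; [move=> ->; rewrite subrr | move/subr0_eq].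
Qed.

Lemma closed_scalar_eq f g : scalar_continuous f -> scalar_continuous g ->
  closed [set t | f t = g t].
Proof.
move=> [f1 f2] [g1 g2].
rewrite (_ : mkset _ = [set t | sre (f t) = sre (g t)]
                       `&` [set t | sim (f t) = sim (g t)]).
  by apply: closedI; exact: closed_real_eq.
by apply/seteqP; split=> t /= /scalar_eqP.
Qed.

Lemma closed_scalar_ge0 f : scalar_continuous f -> closed [set t | 0 <= f t].
Proof.
move=> [f1 f2].
rewrite (_ : mkset _ = (fun t => sre (f t)) @^-1` [set x | 0 <= x]
                       `&` [set t | sim (f t) = 0]).
  apply: closedI; last by apply: closed_real_eq => // t; exact: cvg_cst.
  by apply: preimage_closed => [t _|]; [exact: f1 | exact: closed_ge].
by apply/seteqP; split=> t /= /scalar_ge0P.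
Qed.

End ContinuousScalars.

(** * Real coordinates on matrices and existence of nearest points *)

Definition imunit : F :=
  match K with RealScalars => 0 | ComplexScalars => 'i%C end.

Lemma scalar_decomp (x : F) : x = sreal K (sre x) + imunit * sreal K (sim x).
Proof.
apply/scalar_eqP; rewrite sreD simD sreMM simM !sre_real !sim_real.
rewrite /imunit /sim; case: K x => /= [x|[a b]] /=; split; lra.
Qed.

(* Only a surjection for real scalars, where [imunit] is 0 and the second half
   of the coordinates is discarded; [frob_minimizer] therefore restricts the
   coordinates to a box to get compactness. *)
Definition mx_of_coords q (u : 'rV[R]_(q * q + q * q)) : 'M[F]_q :=
  \matrix_(i, j) (sreal K (u 0 (lshift _ (mxvec_index i j)))
                  + imunit * sreal K (u 0 (rshift _ (mxvec_index i j)))).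

Definition coords_of_mx q (A : 'M[F]_q) : 'rV[R]_(q * q + q * q) :=
  row_mx (mxvec (\matrix_(i, j) sre (A i j))) (mxvec (\matrix_(i, j) sim (A i j))).

Lemma coords_of_mxK q : cancel (@coords_of_mx q) (@mx_of_coords q).
Proof.
move=> A; apply/matrixP => i j.
by rewrite mxE row_mxEl row_mxEr !mxvecE !mxE -scalar_decomp.
Qed.

Lemma coords_of_mx_le q (A : 'M[F]_q) k : coords_of_mx A 0 k ^+ 2 <= frob_dot A A.
Proof.
rewrite -[k]splitK; case: (split k) => l /=; case/mxvec_indexP: l => i j.
  rewrite row_mxEl mxvecE mxE; apply: le_trans (frob_dot_entry A i j).
  by rewrite lerDl sqr_ge0.
rewrite row_mxEr mxvecE mxE; apply: le_trans (frob_dot_entry A i j).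
by rewrite lerDr sqr_ge0.
Qed.

Lemma scalar_continuous_entry q i j :
  scalar_continuous (fun u : 'rV[R]_(q * q + q * q) => mx_of_coords u i j).
Proof.
under eq_fun do rewrite mxE.
apply: scalar_continuousD; last apply: scalar_continuousM.
- by apply: scalar_continuous_real; exact: coord_continuous.
- exact: scalar_continuous_cst.
- by apply: scalar_continuous_real; exact: coord_continuous.
Qed.

(** Direct method: fix [Z] in [C]. Every matrix at least as close to [A] as [Z] has coordinates in a
    fixed box, so it suffices to minimize over a compact set of coordinates. *)
Lemma frob_minimizer q (C : set 'M[F]_q) (A : 'M[F]_q) :
  C !=set0 -> closed (@mx_of_coords q @^-1` C) ->
  exists2 X, C X &
    forall Y, C Y -> frob_dot (X - A) (X - A) <= frob_dot (Y - A) (Y - A).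
Proof.
move=> [Z CZ] clC.
pose f (u : 'rV[R]_(q * q + q * q)) := frob_dot (mx_of_coords u - A) (mx_of_coords u - A).
have cf : continuous f.
  (* The squared distance is the real part of a scalar expression built by sums, products and
     conjugation from continuous entries. *)
  pose g u := \sum_i \sum_j (mx_of_coords u i j - A i j) * sconj (mx_of_coords u i j - A i j).
  have -> : f = fun u => sre (g u).
    apply/funext => u; rewrite /f frob_dotE sre_sum; apply: eq_bigr => i _.
    by rewrite sre_sum; apply: eq_bigr => j _; rewrite !mxE.
  have ce i j : scalar_continuous
      (fun u : 'rV[R]_(q * q + q * q) => mx_of_coords u i j - A i j).
    apply: scalar_continuousD; first exact: scalar_continuous_entry.
    exact: scalar_continuous_cst.
  suff [] : scalar_continuous g by [].
  do 2!apply: scalar_continuous_sum => ?.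
  by apply: scalar_continuousM => //; exact: scalar_continuous_conj.
(* The first two terms bound the squared norm of any [Y] no farther from [A] than [Z], by the
   parallelogram identity. The final 1 passes from a bound on [x ^+ 2] to one on the absolute value
   of [x]. *)
pose B := 2 * frob_dot (Z - A) (Z - A) + 2 * frob_dot A A + 1.
pose box := [set u : 'rV[R]_(q * q + q * q) | forall k, `[- B, B]%classic (u 0 k)].
have cptD : compact (@mx_of_coords q @^-1` C `&` box).
  rewrite setIC; apply: compact_closedI => //.
  by apply: (@rV_compact R _ (fun=> `[- B, B]%classic)) => _; exact: segment_compact.
have inbox Y : frob_dot (Y - A) (Y - A) <= frob_dot (Z - A) (Z - A) -> box (coords_of_mx Y).
  move=> le k /=; rewrite in_itv /= -ler_norml.
  have := coords_of_mx_le Y k; set x := coords_of_mx Y 0 k => leY.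
  have par : frob_dot Y Y + frob_dot (Y - A - A) (Y - A - A)
             = 2 * frob_dot (Y - A) (Y - A) + 2 * frob_dot A A.
    rewrite -{1 2}(subrK A Y).
    rewrite !(frob_dotDl, frob_dotDr, frob_dotNl, frob_dotNr) (frob_dotC A Y).
    by ring.
  have := frob_dot_ge0 (Y - A - A) => ge0.
  have xB : x ^+ 2 + 1 <= B by rewrite /B; lra.
  apply: le_trans xB; rewrite -real_normK ?num_real //.
  (* Nonnegativity of this square gives [y <= y ^+ 2 + 1/4], whence [y <= y ^+ 2 + 1]. *)
  have := sqr_ge0 (`|x| - 2^-1); rewrite sqrrB; set y := `|x| => ?.
  by nra.
have [||u] := compact_EVT_min _ cptD (f := f).
- by exists (coords_of_mx Z); split; [rewrite /= coords_of_mxK | exact: inbox].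
- exact: continuous_subspaceT.
rewrite inE => -[Cu _] minu; exists (mx_of_coords u) => // Y CY.
have minZ : f u <= frob_dot (Z - A) (Z - A).
  rewrite -(coords_of_mxK Z); apply: (minu (coords_of_mx Z)).
  rewrite inE; split; last exact: inbox.
  by rewrite /= coords_of_mxK.
(* A [Y] farther than [Z] is beaten through [Z]; any other [Y] has coordinates in the box. *)
have [le|/ltW gt] := leP (frob_dot (Y - A) (Y - A)) (frob_dot (Z - A) (Z - A)); last first.
  exact: le_trans minZ gt.
rewrite -(coords_of_mxK Y); apply: (minu (coords_of_mx Y)).
rewrite inE; split; last exact: inbox.
by rewrite /= coords_of_mxK.
Qed.

(** * Topology and convexity of the set of density matrices *)

Lemma closed_density_matrices q :
  closed (@mx_of_coords q @^-1` density_matrices K q).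
Proof.
have ce := @scalar_continuous_entry q.
(* One closed condition per entry for self-adjointness, one per test vector for positivity, and one
   for the trace; arbitrary intersections of closed sets remain closed. *)
rewrite (_ : _ @^-1` _ =
  \bigcap_(p in [set: 'I_q * 'I_q])
      [set u | sconj (mx_of_coords u p.2 p.1) = mx_of_coords u p.1 p.2] `&`
  \bigcap_(x in [set: 'cV[F]_q])
      [set u | 0 <= \sum_j (\sum_i sconj (x i 0) * mx_of_coords u i j) * x j 0] `&`
  [set u | \sum_i mx_of_coords u i i = 1]).
  apply: closedI; first apply: closedI.
  - by apply: closed_bigI => p _; apply: closed_scalar_eq => //;
       exact: scalar_continuous_conj.
  - apply: closed_bigI => x _; apply: closed_scalar_ge0.
    apply: scalar_continuous_sum => j.
    apply: scalar_continuousM; last exact: scalar_continuous_cst.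
    apply: scalar_continuous_sum => i.
    by apply: scalar_continuousM => //; exact: scalar_continuous_cst.
  - by apply: closed_scalar_eq; [exact: scalar_continuous_sum | exact: scalar_continuous_cst].
have form (A : 'M[F]_q) (x : 'cV[F]_q) :
    (adj x *m A *m x) 0 0 = \sum_j (\sum_i sconj (x i 0) * A i j) * x j 0.
  rewrite mxE; apply: eq_bigr => j _; rewrite mxE; congr (_ * _).
  by apply: eq_bigr => i _; rewrite !mxE.
apply/seteqP; split=> u /= [[sa psd] tr]; split=> //; split.
- by move=> p _ /=; rewrite -[in RHS]sa [in RHS]mxE [in RHS]mxE.
- by move=> x _ /=; rewrite -form.
- by apply/matrixP => i j; rewrite [LHS]mxE [in LHS]mxE; exact: (sa (i, j)).
- by move=> x; rewrite form; exact: psd.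
Qed.

(** Midpoints are all the convexity that uniqueness of the projection uses. *)
Lemma density_matrices_mid q (A B : 'M[F]_q) :
  density_matrices K q A -> density_matrices K q B ->
  density_matrices K q (sreal K 2^-1 *: (A + B)).
Proof.
move=> [[saA psdA] trA] [[saB psdB] trB]; split; first split.
- by apply/self_adjointZ/self_adjointD.
- move=> x; rewrite -scalemxAr -scalemxAl mxE mulmxDr mulmxDl mxE.
  by rewrite mulr_ge0 ?addr_ge0 // sreal_ge0 // invr_ge0.
- rewrite mxtraceZ raddfD /= trA trB -[1 + 1]/(2%:R) -(sreal_nat R K 2) -sreal_mul mulVf ?sreal1 //.
  by rewrite pnatr_eq0.
Qed.

Lemma density_matrices_neq0 q : (0 < q)%N -> @density_matrices R K q !=set0.
Proof.
move=> q_gt0; exists (sreal K q%:R^-1 *: 1%:M); split; first split.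
- exact/self_adjointZ/self_adjoint1.
- move=> x; rewrite -scalemxAr -scalemxAl mulmx1 mxE.
  rewrite mulr_ge0 ?sreal_ge0 ?invr_ge0 // mxE sumr_ge0 // => i _; rewrite !mxE.
  (* Positivity in [F] also requires the product of an entry with its conjugate to be real. *)
  apply/scalar_ge0P; split; first by rewrite mulrC sre_mulconj_ge0.
  by rewrite simM sre_conj sim_conj; ring.
- rewrite mxtraceZ mxtrace1 -(sreal_nat R K) -sreal_mul mulVf ?sreal1 //.
  by rewrite pnatr_eq0 -lt0n.
Qed.

(** For uniqueness, the midpoint of two nearest points is again a density matrix; were the points
    distinct, it would be strictly closer to [A]. *)
Lemma argmin_frob_density q (A : 'M[F]_q) : (0 < q)%N ->
  exists rho, argmin (fun S => frob_norm (S - A)) (density_matrices K q) = [set rho].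
Proof.
move=> /density_matrices_neq0 /frob_minimizer/(_ (@closed_density_matrices q)).
move=> /(_ A)[X dX minX]; exists X; apply/seteqP; split=> [Z [dZ minZ]|Z /= ->]; last first.
  by split=> // S dS; rewrite ler_frob_norm; exact: minX.
have leZX : frob_dot (Z - A) (Z - A) <= frob_dot (X - A) (X - A).
  by rewrite -ler_frob_norm; exact: minZ.
have := minX _ (density_matrices_mid dX dZ).
have -> : sreal K 2^-1 *: (X + Z) - A = sreal K 2^-1 *: ((X - A) + (Z - A)).
  rewrite addrACA -opprD scalerBr; congr (_ - _).
  rewrite -mulr2n -[A *+ 2]scaler_nat scalerA -(sreal_nat R K 2) -sreal_mul mulVf.
    by rewrite sreal1 scale1r.
  by rewrite pnatr_eq0.
move=> leM; apply/eqP; rewrite -subr_eq0; apply/eqP/frob_dot_eq0.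
have -> : Z - X = (Z - A) - (X - A) by rewrite opprB addrA subrK.
have := frob_dot_ge0 (Z - A - (X - A)).
(* The midpoint bound reads [|V + W|^2 >= 4 |V|^2], so [|W - V|^2 = 2 |V|^2 + 2 |W|^2 - |V + W|^2 <=
   2 (|W|^2 - |V|^2) <= 0]. *)
move: leM leZX; move: (X - A) (Z - A) => V W.
rewrite frob_dotZl frob_dotZr !(frob_dotDl, frob_dotDr, frob_dotNl, frob_dotNr).
rewrite (frob_dotC W V) => ? ? ?; lra.
Qed.

End Projection.

Theorem corollary4p13 (R : realType) (K : scalar_kind) (q n r : nat)
    (hq : (2 <= q)%N) (hn : (1 <= n)%N) (hr : (1 <= r)%N)
    (O : 'I_n -> 'M[scalar_field R K]_q)
    (hO : forall i, self_adjoint (O i))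
    (s : forall i, spectral_resolution (O i))
    (alpha : R) (halpha : 0 < alpha) (hdesign : unitary_design s alpha)
    (Y : 'I_n -> 'I_r -> R)
    (hY : forall i j, exists k : 'I_(nev (s i)), Y i j = eigval k) :
  let Loss := loss s (data_matrix s Y) in
  exists rho_LSE : 'M[scalar_field R K]_q,
    argmin Loss (unit_trace_sa K q) = [set rho_LSE] /\
    exists rho : 'M[scalar_field R K]_q,
      argmin (fun S => frob_norm (S - rho_LSE)) (density_matrices K q)
        = [set rho] /\
      argmin Loss (density_matrices K q) = [set rho].
Proof.
move=> Loss; have q_gt0 : (0 < q)%N := ltnW hq.
have [L uL lossE] := loss_unit_trace hn hdesign (data_matrix s Y) q_gt0 halpha.
have na_gt0 : 0 < n%:R * alpha by rewrite mulr_gt0 // ltr0n.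
exists L; split.
  apply/seteqP; split=> [S [uS minS]|S /= ->]; last first.
    by split=> // S' uS'; rewrite /Loss (lossE _ uS') lerDl mulr_ge0 ?frob_dot_ge0 // ltW.
  (* Another minimizer [S] has zero excess loss, and this excess is a positive multiple of its
     squared distance to [L]. *)
  have := minS _ uL; rewrite /Loss (lossE _ uS) gerDl pmulr_rle0 // => le0.
  by apply/eqP; rewrite -subr_eq0; apply/eqP/frob_dot_eq0/le_anti; rewrite le0 frob_dot_ge0.
have [rho argmin_rho] := argmin_frob_density L q_gt0; exists rho; split=> //.
rewrite -argmin_rho.
have density_unit S : density_matrices K q S -> unit_trace_sa K q S by case=> -[].
(* On density matrices the loss is an increasing function of the distance to [L], so both criteria
   induce the same order and have the same minimizers. *)
have le_loss S S' : density_matrices K q S -> density_matrices K q S' ->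
    (Loss S <= Loss S') = (frob_norm (S - L) <= frob_norm (S' - L)).
  move=> /density_unit uS /density_unit uS'.
  by rewrite /Loss (lossE _ uS) (lossE _ uS') lerD2l ler_pM2l // ler_frob_norm.
by apply/seteqP; split=> S [dS minS]; split=> // S' dS'; have := minS _ dS'; rewrite le_loss.
Qed.
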